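(* Let $L$ be a loop with identity $e$, $G$ a middle and right nuclear normal subgroup of $L$, $\kappa:K\to L/G$ an isomorphism from a loop $K$ (with identity $\epsilon$), and $\Sigma$ a left transversal to $G$ in $L$; put $\{l_\sigma\}=\Sigma\cap\kappa(\sigma)$, and let $K\times_f^{\Theta}G$ be the Schreier extension corresponding to the data triple $(G,\kappa,\Sigma)$. Let $n:K\to G$ be a function with $n(\epsilon)=e$ and consider the left transversal $\bar\Sigma=\{l_\sigma n(\sigma);\ \sigma\in K\}$ (where $l_\sigma n(\sigma)\in\kappa(\sigma)$). Then the maps $\bar\Theta:K\to\mathrm{Aut}(G)$ and $\bar f:K\times K\to G$ of the Schreier extension $K\times_{\bar f}^{\bar\Theta}G$ corresponding to the data triple $(G,\kappa,\bar\Sigma)$ are $$\bar\Theta_\sigma=\iota_{n(\sigma)}^{-1}\circ\Theta_\sigma,\qquad \bar f(\sigma,\tau)=n(\sigma\tau)^{-1}f(\sigma,\tau)\,\Theta_\tau(n(\sigma))\,n(\tau),\qquad \sigma,\tau\in K.$$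
   Context: A subgroup $G$ of a loop $L$ is middle (right) nuclear if it is contained in the middle nucleus $\{u: xu\cdot y=x\cdot uy\ \forall x,y\in L\}$ (right nucleus $\{u: xy\cdot u=x\cdot yu\ \forall x,y\in L\}$). A left transversal to $G$ in $L$ is a set of exactly one representative of each left coset of $G$, containing $e$. For $x,y\in L$, $x\backslash y$ is the unique $z$ with $xz=y$. For $r,t\in G$, $\iota_r(t)=rtr^{-1}$. Given a data triple $(G,\kappa,\Sigma)$ with $\{l_\sigma\}=\Sigma\cap\kappa(\sigma)$, the corresponding Schreier extension $K\times_f^{\Theta}G$ is the loop on $K\times G$ with multiplication $(\sigma,s)(\tau,t)=(\sigma\tau,f(\sigma,\tau)\Theta_\tau(s)t)$, where $\Theta_\sigma\in\mathrm{Aut}(G)$ is defined by $\Theta_\sigma(s)=l_\sigma\backslash(s\,l_\sigma)$ and $f(\sigma,\tau)=l_{\sigma\tau}\backslash(l_\sigma l_\tau)\in G$; the map $(\sigma,s)\mapsto l_\sigma s$ is then an isomorphism $K\times_f^{\Theta}G\to L$. *)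

(* Defs.v *)
From HB Require Import structures.
From mathcomp Require Import all_boot.
From mathcomp Require Import boolp classical_sets.

Set Implicit Arguments.
Unset Strict Implicit.
Unset Printing Implicit Defensive.

Local Open Scope classical_set_scope.
Local Open Scope group_scope.

Reserved Notation "x \\ y" (at level 40, left associativity).

(* MathComp's unitary magmas (umagmaType) carry a choiceType structure; every
   type has one under the classical axioms of boolp.
   A loop is a unital magma in which x * z = y and z * x = y are uniquely
   solvable for z: ldiv x y and rdiv y x are those unique solutions. *)
HB.mixin Record UMagma_isLoop L of UMagma L := {
  ldiv : L -> L -> L;
  rdiv : L -> L -> L;
  ldivP : forall x y z : L, x * z = y <-> z = ldiv x y;
  rdivP : forall x y z : L, z * x = y <-> z = rdiv y x
}.

#[short(type="loopType")]
HB.structure Definition Loop := {L of UMagma_isLoop L & UMagma L}.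

Bind Scope group_scope with Loop.sort.

Notation "x \\ y" := (ldiv x y) : group_scope.

Section LoopTheory.
Variable L : loopType.
Implicit Types x y z : L.

Lemma mul_ldiv x y : x * (x \\ y) = y. Proof. exact/ldivP. Qed.
Lemma ldiv_mul x y : x \\ (x * y) = y. Proof. exact/esym/ldivP. Qed.
Lemma mul_rdiv x y : rdiv y x * x = y. Proof. exact/rdivP. Qed.
Lemma rdiv_mul x y : rdiv (y * x) x = y. Proof. exact/esym/rdivP. Qed.
Lemma loop_mulI x y z : x * y = x * z -> y = z.
Proof. by move/(congr1 (ldiv x)); rewrite !ldiv_mul. Qed.
Lemma loop_mulIr x y z : y * x = z * x -> y = z.
Proof. by move/(congr1 (fun u => rdiv u x)); rewrite !rdiv_mul. Qed.

End LoopTheory.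

Record loop_iso (K L : loopType) := LoopIso {
  loop_iso_fun :> K -> L;
  loop_isoM : {morph loop_iso_fun : x y / x * y};
  loop_iso_bij : bijective loop_iso_fun
}.

Section Subloops.
Variable L : loopType.

Definition lcoset (x : L) (A : set L) : set L := [set x * a | a in A].
Definition rcoset (A : set L) (x : L) : set L := [set a * x | a in A].

Definition middle_nucleus : set L :=
  [set u | forall x y : L, (x * u) * y = x * (u * y)].
Definition right_nucleus : set L :=
  [set u | forall x y : L, (x * y) * u = x * (y * u)].

Record is_subloop (N : set L) : Prop := {
  subloop1 : N 1;
  subloopM : forall x y, N x -> N y -> N (x * y);
  subloopVl : forall x y, N x -> N y -> N (x \\ y);
  subloopVr : forall x y, N x -> N y -> N (rdiv x y)
}.

Record is_subgroup (G : set L) : Prop := {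
  subgroup_subloop : is_subloop G;
  subgroupA : forall x y z, G x -> G y -> G z -> x * (y * z) = (x * y) * z
}.

(* Bruck's conditions xN = Nx, x(yN) = (xy)N, (Nx)y = N(xy); the remaining
   one, (xN)y = x(Ny), follows from these. *)
Record is_normal (N : set L) : Prop := {
  normal_subloop : is_subloop N;
  normalC : forall x, lcoset x N = rcoset N x;
  normalAl : forall x y, lcoset x (lcoset y N) = lcoset (x * y) N;
  normalAr : forall x y, rcoset (rcoset N x) y = rcoset N (x * y)
}.

Record normal_sub := NormalSub {
  normal_sub_set :> set L;
  normal_subP : is_normal normal_sub_set
}.

Record nuclear_normal_subgroup := NuclearNormalSubgroup {
  nuclear_normal_sub :> normal_sub;
  nuclear_subgroup : is_subgroup nuclear_normal_sub;
  nuclear_middle : nuclear_normal_sub `<=` middle_nucleus;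
  nuclear_right : nuclear_normal_sub `<=` right_nucleus
}.

End Subloops.

Section Quotient.
Variables (L : loopType) (N0 : normal_sub L).
Local Notation N := (normal_sub_set N0).

(* L/N: the left cosets of N under the setwise product C * D = {uv | u in C,
   v in D}. *)
Definition quotient : Type := set_type [set lcoset x N | x in setT].
HB.instance Definition _ := Choice.on quotient.

Definition coset_set (C : quotient) : set L := val C.

Lemma lcoset_in x : lcoset x N \in [set lcoset x N | x in setT].
Proof. by rewrite inE; exists x. Qed.

Definition coset (x : L) : quotient := SigSub (lcoset_in x).

Lemma quotient_eq (C D : quotient) : coset_set C = coset_set D -> C = D.
Proof. exact: val_inj. Qed.

Lemma cosetP (C : quotient) : exists x, C = coset x.
Proof.
case: C => A HA; have := HA; rewrite inE => -[x _ xA].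
by exists x; apply: val_inj; rewrite /= xA.
Qed.

Let N1 : N 1 := subloop1 (normal_subloop (normal_subP N0)).
Let NM := subloopM (normal_subloop (normal_subP N0)).
Let NVl := subloopVl (normal_subloop (normal_subP N0)).

Lemma lcoset_refl x : lcoset x N x.
Proof. by exists 1; rewrite ?mulg1. Qed.

Lemma lcosetN x : N x -> lcoset x N = N.
Proof.
move=> Nx; apply/seteqP; split=> y; first by move=> [a Na <-]; exact: NM.
by move=> Ny; exists (x \\ y); [exact: NVl | rewrite mul_ldiv].
Qed.

Lemma lcoset_mem x y : lcoset x N y -> lcoset y N = lcoset x N.
Proof.
move=> [a Na <-]; by rewrite -(normalAl (normal_subP N0)) lcosetN.
Qed.

Lemma lcosetM x y u v :
  lcoset x N u -> lcoset y N v -> lcoset (u * v) N = lcoset (x * y) N.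
Proof.
have nN := normal_subP N0; move=> /lcoset_mem xu /lcoset_mem yv.
rewrite -(normalAl nN) yv (normalAl nN) (normalC nN) -(normalAr nN).
by rewrite -(normalC nN) xu (normalC nN) (normalAr nN) -(normalC nN).
Qed.

Lemma mul_coset_subproof (C D : quotient) :
  [set u * v | u in coset_set C & v in coset_set D]
    \in [set lcoset x N | x in setT].
Proof.
have [x ->] := cosetP C; have [y ->] := cosetP D; rewrite inE /coset_set /=.
exists (x * y) => //; apply/seteqP; split.
  rewrite -(normalAl (normal_subP N0)) => _ [v yv <-].
  by exists x; [exact: lcoset_refl | exists v].
by move=> _ [u xu] [v yv <-]; rewrite -(lcosetM xu yv); exact: lcoset_refl.
Qed.

Definition quotient_mul (C D : quotient) : quotient :=
  SigSub (mul_coset_subproof C D).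
Definition quotient_repr (C : quotient) : L := xget 1 (coset_set C).
Definition quotient_ldiv (C D : quotient) : quotient :=
  coset (quotient_repr C \\ quotient_repr D).
Definition quotient_rdiv (C D : quotient) : quotient :=
  coset (rdiv (quotient_repr C) (quotient_repr D)).

Lemma coset_repr C : coset (quotient_repr C) = C.
Proof.
have [x ->] := cosetP C; apply: quotient_eq; apply: lcoset_mem.
rewrite /quotient_repr; case: xgetP => [y -> //|] /(_ x) []; exact: lcoset_refl.
Qed.

Lemma coset_mulE x y : quotient_mul (coset x) (coset y) = coset (x * y).
Proof.
have [z zE] := cosetP (quotient_mul (coset x) (coset y)).
rewrite zE; apply/esym/quotient_eq/lcoset_mem.
have <- : coset_set (quotient_mul (coset x) (coset y)) = lcoset z N.
  by rewrite zE.
by exists x; [exact: lcoset_refl | exists y => //; exact: lcoset_refl].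
Qed.

Lemma coset_mulI x y z : coset (x * y) = coset (x * z) -> coset y = coset z.
Proof.
move=> /(congr1 coset_set) xyz; apply: quotient_eq; apply: lcoset_mem.
have : lcoset (x * z) N (x * y) by rewrite -[lcoset _ _]xyz; exact: lcoset_refl.
by rewrite -(normalAl (normal_subP N0)) => -[v zv /loop_mulI <-].
Qed.

Lemma coset_mulIr x y z : coset (y * x) = coset (z * x) -> coset y = coset z.
Proof.
have nN := normal_subP N0.
move=> /(congr1 coset_set) xyz; apply: quotient_eq; apply: lcoset_mem.
have : lcoset (z * x) N (y * x) by rewrite -[lcoset _ _]xyz; exact: lcoset_refl.
rewrite (normalC nN) -(normalAr nN) => -[v zv /loop_mulIr <-].
by rewrite (normalC nN).
Qed.

Lemma quotient_mul1g : left_id (coset 1) quotient_mul.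
Proof. by move=> C; have [x ->] := cosetP C; rewrite coset_mulE mul1g. Qed.
Lemma quotient_mulg1 : right_id (coset 1) quotient_mul.
Proof. by move=> C; have [x ->] := cosetP C; rewrite coset_mulE mulg1. Qed.

Lemma quotient_ldivP C D E : quotient_mul C E = D <-> E = quotient_ldiv C D.
Proof.
rewrite -{1}(coset_repr C) -{1}(coset_repr D) -{1 2}(coset_repr E).
rewrite coset_mulE /quotient_ldiv.
split=> [|ED]; last by rewrite -coset_mulE ED coset_mulE mul_ldiv.
rewrite -{1}(mul_ldiv (quotient_repr C) (quotient_repr D)).
exact: coset_mulI.
Qed.

Lemma quotient_rdivP C D E : quotient_mul E C = D <-> E = quotient_rdiv D C.
Proof.
rewrite -{1}(coset_repr C) -{1}(coset_repr D) -{1 2}(coset_repr E).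
rewrite coset_mulE /quotient_rdiv.
split=> [|ED]; last by rewrite -coset_mulE ED coset_mulE mul_rdiv.
rewrite -{1}(mul_rdiv (quotient_repr C) (quotient_repr D)).
exact: coset_mulIr.
Qed.

HB.instance Definition _ := hasMul.Build quotient quotient_mul.
HB.instance Definition _ :=
  Magma_isUMagma.Build quotient quotient_mul1g quotient_mulg1.
HB.instance Definition _ :=
  UMagma_isLoop.Build quotient quotient_ldivP quotient_rdivP.

End Quotient.

Section SubgroupType.
Variables (L : loopType) (G : nuclear_normal_subgroup L).

(* The subset G of L as a type, with the operations of L: a groupType. *)
Definition group_of : Type := set_type G.
HB.instance Definition _ := Choice.on group_of.

Definition group_val (u : group_of) : L := val u.

Lemma group_valP u : (G : set L) (group_val u). Proof. exact: set_valP. Qed.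

Lemma group_val_inj : injective group_val. Proof. exact: val_inj. Qed.

Definition group_elt (x : L) (Gx : (G : set L) x) : group_of := SigSub (mem_set Gx).

Let sG := nuclear_subgroup G.
Let slG := subgroup_subloop sG.

Definition group_mul (u v : group_of) : group_of :=
  group_elt (subloopM slG (group_valP u) (group_valP v)).
Definition group_one : group_of := group_elt (subloop1 slG).
Definition group_inv (u : group_of) : group_of :=
  group_elt (subloopVl slG (group_valP u) (subloop1 slG)).

Lemma group_mulA : associative group_mul.
Proof.
move=> u v w; apply: group_val_inj.
by apply: (subgroupA sG); exact: group_valP.
Qed.
Lemma group_mul1g : left_id group_one group_mul.
Proof. by move=> u; apply: group_val_inj; exact: mul1g. Qed.
Lemma group_mulg1 : right_id group_one group_mul.
Proof. by move=> u; apply: group_val_inj; exact: mulg1. Qed.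
Lemma group_mulgV : right_inverse group_one group_inv group_mul.
Proof. by move=> u; apply: group_val_inj; exact: mul_ldiv. Qed.
Lemma group_mulVg : left_inverse group_one group_inv group_mul.
Proof.
move=> u; apply: group_val_inj; apply: (@loop_mulI _ (group_val u)).
rewrite /= (subgroupA sG) ?mul_ldiv ?mul1g ?mulg1 //; exact: group_valP.
Qed.

HB.instance Definition _ := isGroup.Build group_of
  group_mulA group_mul1g group_mulg1 group_mulVg group_mulgV.

Lemma group_valM : {morph group_val : u v / u * v}. Proof. by []. Qed.

End SubgroupType.

Record automorphism (G : groupType) := Automorphism {
  aut_fun :> G -> G;
  autM : {morph aut_fun : x y / x * y};
  aut_bij : bijective aut_fun
}.

Section Automorphisms.
Variable G : groupType.
Implicit Types f g : automorphism G.

Lemma aut_eq f g : f =1 g -> f = g.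
Proof.
case: f g => [f fM fb] [g gM gb] /= /funext E; subst g.
by congr Automorphism; exact: Prop_irrelevance.
Qed.

Lemma aut_id_subproof : {morph (@id G) : x y / x * y}. Proof. by []. Qed.
Definition aut_id : automorphism G :=
  Automorphism aut_id_subproof (inv_bij (fun=> erefl)).

Lemma aut_comp_subproof f g : {morph f \o g : x y / x * y}.
Proof. by move=> x y /=; rewrite !autM. Qed.
Definition aut_comp f g : automorphism G :=
  Automorphism (@aut_comp_subproof f g) (bij_comp (aut_bij f) (aut_bij g)).

Lemma aut_inv_ex f : exists g : G -> G, cancel f g /\ cancel g f.
Proof. by have [g fK gK] := aut_bij f; exists g. Qed.
Definition aut_inv_fun f : G -> G := projT1 (cid (aut_inv_ex f)).
Lemma aut_funK f : cancel f (aut_inv_fun f).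
Proof. by rewrite /aut_inv_fun; case: cid => g []. Qed.
Lemma aut_invK f : cancel (aut_inv_fun f) f.
Proof. by rewrite /aut_inv_fun; case: cid => g []. Qed.
Lemma aut_invM f : {morph aut_inv_fun f : x y / x * y}.
Proof.
by move=> x y; apply: (bij_inj (aut_bij f)); rewrite autM !aut_invK.
Qed.
Definition aut_inv f : automorphism G :=
  Automorphism (@aut_invM f) (Bijective (@aut_invK f) (@aut_funK f)).

Definition inner_fun (r t : G) : G := r * t * r^-1.
Lemma inner_funM r : {morph inner_fun r : x y / x * y}.
Proof. by move=> x y; rewrite /inner_fun !mulgA mulgVK. Qed.
Lemma inner_fun_bij r : bijective (inner_fun r).
Proof.
exists (fun t => r^-1 * t * r) => t.
  by rewrite /inner_fun !mulgA mulVg mul1g mulgVK.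
by rewrite /inner_fun !mulgA mulgV mul1g mulgK.
Qed.
Definition inner (r : G) : automorphism G :=
  Automorphism (@inner_funM r) (@inner_fun_bij r).

End Automorphisms.

Notation "f \oA g" := (aut_comp f g)
  (at level 50, left associativity) : group_scope.

(* The pairs (Theta, f) for which the product on K * G below has unit (1, 1). *)
Record schreier_data (K : loopType) (G : groupType) := SchreierData {
  schreier_theta : K -> automorphism G;
  schreier_factor : K -> K -> G;
  schreier_theta1 : schreier_theta 1 = aut_id G;
  schreier_factor1l : forall s : K, schreier_factor 1 s = 1;
  schreier_factor1r : forall s : K, schreier_factor s 1 = 1
}.

(* The loop on K * G defined by E. The argument E is a phantom, on which the
   inferred loop structure depends. *)
Definition schreier_ext (K : loopType) (G : groupType)
  (E : schreier_data K G) : Type := (K * G)%type.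

Section SchreierExtension.
Variables (K : loopType) (G : groupType) (E : schreier_data K G).
Local Notation Theta := (schreier_theta E).
Local Notation f := (schreier_factor E).

HB.instance Definition _ := Choice.on (schreier_ext E).

Definition schreier_mul (a b : schreier_ext E) : schreier_ext E :=
  (a.1 * b.1, f a.1 b.1 * Theta b.1 a.2 * b.2).
Definition schreier_one : schreier_ext E := (1, 1).
Definition schreier_ldiv (a b : schreier_ext E) : schreier_ext E :=
  let t := a.1 \\ b.1 in (t, (f a.1 t * Theta t a.2)^-1 * b.2).
Definition schreier_rdiv (b a : schreier_ext E) : schreier_ext E :=
  let s := rdiv b.1 a.1 in
  (s, aut_inv (Theta a.1) ((f s a.1)^-1 * (b.2 * a.2^-1))).

Lemma autm1 (h : automorphism G) : h 1 = 1.
Proof. by apply: (@mulgI _ (h 1)); rewrite -autM !mulg1. Qed.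

Lemma schreier_mul1g : left_id schreier_one schreier_mul.
Proof.
by case=> s u; rewrite /schreier_mul /= mul1g schreier_factor1l autm1 !mul1g.
Qed.
Lemma schreier_mulg1 : right_id schreier_one schreier_mul.
Proof.
case=> s u; rewrite /schreier_mul /= mulg1 schreier_factor1r.
by rewrite schreier_theta1 /= mul1g mulg1.
Qed.
Lemma schreier_ldivP a b c :
  schreier_mul a c = b <-> c = schreier_ldiv a b.
Proof.
case: a b c => [s u] [t v] [r w]; rewrite /schreier_mul /schreier_ldiv /=.
split=> [[<- <-]|[-> ->]]; first by rewrite ldiv_mul mulKg.
by rewrite mul_ldiv mulVKg.
Qed.
Lemma schreier_rdivP a b c :
  schreier_mul c a = b <-> c = schreier_rdiv b a.
Proof.
case: a b c => [s u] [t v] [r w]; rewrite /schreier_mul /schreier_rdiv /=.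
split=> [[<- <-]|[-> ->]]; first by rewrite rdiv_mul mulgK mulKg aut_funK.
by rewrite mul_rdiv aut_invK mulVKg mulgVK.
Qed.

HB.instance Definition _ := hasMul.Build (schreier_ext E) schreier_mul.
HB.instance Definition _ :=
  Magma_isUMagma.Build (schreier_ext E) schreier_mul1g schreier_mulg1.
HB.instance Definition _ :=
  UMagma_isLoop.Build (schreier_ext E) schreier_ldivP schreier_rdivP.

End SchreierExtension.

Record left_transversal (L : loopType) (N : normal_sub L) := LeftTransversal {
  transversal_set :> set L;
  transversal1 : transversal_set 1;
  transversal_coset : forall C : quotient N,
    exists l, transversal_set `&` coset_set C = [set l]
}.

Section DataTriple.
Variables (L K : loopType) (G : nuclear_normal_subgroup L).
Variables (kappa : loop_iso K (quotient G)) (S : left_transversal G).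
Implicit Types s t : K.

(* rep s is l_s, the element of S in the coset kappa s. *)
Definition rep s : L :=
  projT1 (cid (transversal_coset S (kappa s))).
Local Notation l := rep.

Lemma repP s : S `&` coset_set (kappa s) = [set l s].
Proof. by rewrite /rep; case: cid. Qed.

Lemma rep_in_coset s : coset_set (kappa s) (l s).
Proof. by have [] : (S `&` coset_set (kappa s)) (l s) by rewrite repP. Qed.

Lemma kappaE s : kappa s = coset G (l s).
Proof.
apply: quotient_eq; have := rep_in_coset s; have [x ->] := cosetP (kappa s).
by move/lcoset_mem.
Qed.

Lemma kappa1 : kappa 1 = 1.
Proof.
apply: (@loop_mulI _ (kappa 1)).
by rewrite -loop_isoM !mulg1.
Qed.

Lemma rep1 : l 1 = 1.
Proof.
have : (S `&` coset_set (kappa 1)) 1.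
  by split; [exact: transversal1 | rewrite kappa1; exact: lcoset_refl].
by rewrite repP => <-.
Qed.

Let nG := normal_subP G.

Lemma theta_in s (u : group_of G) : (G : set L) (l s \\ (group_val u * l s)).
Proof.
have : rcoset G (l s) (group_val u * l s) by exists (group_val u) => //; exact: group_valP.
by rewrite -(normalC nG) => -[a Ga <-]; rewrite ldiv_mul.
Qed.
Definition theta_fun s (u : group_of G) : group_of G := group_elt (theta_in s u).

Lemma theta_funE s u : l s * group_val (theta_fun s u) = group_val u * l s.
Proof. exact: mul_ldiv. Qed.

Lemma theta_funM s : {morph theta_fun s : u v / u * v}.
Proof.
move=> u v; apply: group_val_inj; apply: (@loop_mulI _ (l s)).
have nr w := nuclear_right (group_valP w).
have nm w := nuclear_middle (group_valP w).
by rewrite theta_funE !group_valM -nr theta_funE nr theta_funE nm.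
Qed.

Lemma theta_fun_bij s : bijective (theta_fun s).
Proof.
have inv_in (u : group_of G) : (G : set L) (rdiv (l s * group_val u) (l s)).
  have : lcoset (l s) G (l s * group_val u).
    by exists (group_val u) => //; exact: group_valP.
  by rewrite (normalC nG) => -[a Ga <-]; rewrite rdiv_mul.
exists (fun u => group_elt (inv_in u)) => u; apply: group_val_inj.
  by apply: (@loop_mulIr _ (l s)); rewrite mul_rdiv theta_funE.
by apply: (@loop_mulI _ (l s)); rewrite theta_funE mul_rdiv.
Qed.

Definition theta s : automorphism (group_of G) :=
  Automorphism (@theta_funM s) (@theta_fun_bij s).

Lemma factor_in s t : (G : set L) (l (s * t) \\ (l s * l t)).
Proof.
have : coset_set (coset G (l (s * t))) (l s * l t).
  rewrite -kappaE loop_isoM; exists (l s); first exact: rep_in_coset.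
  by exists (l t) => //; exact: rep_in_coset.
by move=> [a Ga <-]; rewrite ldiv_mul.
Qed.
Definition factor s t : group_of G := group_elt (factor_in s t).

Lemma factorE s t : l (s * t) * group_val (factor s t) = l s * l t.
Proof. exact: mul_ldiv. Qed.

Lemma theta1 : theta 1 = aut_id (group_of G).
Proof.
apply: aut_eq => u; apply: group_val_inj; apply: (@loop_mulI _ (l 1)).
by rewrite theta_funE rep1 mulg1 mul1g.
Qed.
Lemma factor1l s : factor 1 s = 1.
Proof.
apply: group_val_inj; apply: (@loop_mulI _ (l (1 * s))).
by rewrite mul_ldiv rep1 !mul1g mulg1.
Qed.
Lemma factor1r s : factor s 1 = 1.
Proof.
apply: group_val_inj; apply: (@loop_mulI _ (l (s * 1))).
by rewrite mul_ldiv rep1 !mulg1.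
Qed.

(* The pair (Theta, f) of the Schreier extension of the triple (G, kappa, S). *)
Definition schreier_of : schreier_data K (group_of G) :=
  SchreierData theta1 factor1l factor1r.

Definition schreier_map (a : schreier_ext schreier_of) : L :=
  l a.1 * group_val a.2.

Lemma schreier_mapM : {morph schreier_map : a b / a * b}.
Proof.
move=> [s u] [t v]; rewrite /schreier_map /= !group_valM.
have nr (w : group_of G) := nuclear_right (group_valP w).
have nm (w : group_of G) := nuclear_middle (group_valP w).
by rewrite -!nr factorE; congr (_ * _); rewrite nm -theta_funE nr.
Qed.

Lemma schreier_map_bij : bijective schreier_map.
Proof.
have inv_ex x : exists a, schreier_map a = x.
  have [k kK Kk] := loop_iso_bij kappa.
  have : coset_set (kappa (k (coset G x))) x by rewrite Kk; exact: lcoset_refl.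
  rewrite kappaE => -[a Ga <-].
  by exists (k (coset G x), group_elt Ga).
have inj : injective schreier_map.
  move=> [s u] [t v]; rewrite /schreier_map /= => E.
  have st : s = t.
    apply: (bij_inj (loop_iso_bij kappa)); apply: quotient_eq.
    rewrite !kappaE; apply: lcoset_mem.
    have -> : lcoset (l t) G = lcoset (l t * group_val v) G.
      by apply/esym/lcoset_mem; exists (group_val v) => //; exact: group_valP.
    rewrite -E (@lcoset_mem _ G (l s)); first exact: lcoset_refl.
    by exists (group_val u) => //; exact: group_valP.
  by move: E; rewrite st => /loop_mulI/group_val_inj ->.
exists (fun x => projT1 (cid (inv_ex x))) => a; last by case: cid.
by apply: inj; case: cid.
Qed.

End DataTriple.

(* Main.v *)
(* Write m_s = l_s n(s). Left multiplication by m_s and m_(st) is compared with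
   left multiplication by l_s and l_(st): moving the nuclear elements across
   brackets turns  m_s Theta'_s(u) = u m_s  into
   l_s (n(s) Theta'_s(u)) = l_s (Theta_s(u) n(s)),  and
   m_(st) f'(s,t) = m_s m_t  into
   l_(st) (n(st) f'(s,t)) = l_(st) (f(s,t) Theta_t(n(s)) n(t));
   the leftmost factor then cancels. *)
Require Import Defs.
From HB Require Import structures.
From mathcomp Require Import all_boot.
From mathcomp Require Import boolp classical_sets.

Set Implicit Arguments.
Unset Strict Implicit.

Local Open Scope classical_set_scope.
Local Open Scope group_scope.

(** [aut_inv] is a chosen inverse and does not compute; applying the injective [inner r] to both
    sides determines its value. *)
Lemma aut_inv_innerE (G : groupType) (r t : G) :
  aut_inv (inner r) t = r^-1 * t * r.
Proof.
apply: (bij_inj (aut_bij (inner r))).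
by rewrite [LHS]aut_invK /= /inner_fun !mulgA mulgV mul1g mulgK.
Qed.

Section ChangeOfTransversal.
Variables (L K : loopType) (G : nuclear_normal_subgroup L).
Variables (kappa : loop_iso K (quotient G)) (S : left_transversal G).
Variable n : K -> group_of G.
Local Notation l := (rep kappa S).

Lemma group_mul_middle (x y : L) (u : group_of G) :
  (x * group_val u) * y = x * (group_val u * y).
Proof. exact: (nuclear_middle (group_valP u)). Qed.

Lemma group_mul_right (x y : L) (u : group_of G) :
  (x * y) * group_val u = x * (y * group_val u).
Proof. exact: (nuclear_right (group_valP u)). Qed.

Definition shifted_set : set L :=
  [set l s * group_val (n s) | s in [set: K]].

Lemma shifted_in_coset s : coset_set (kappa s) (l s * group_val (n s)).
Proof.
by rewrite (kappaE kappa S); exists (group_val (n s)) => //; exact: group_valP.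
Qed.

(** A shifted point of index [t] lies in [kappa t]; if it also lies in [kappa s], the two cosets
    coincide and injectivity of [kappa] forces [t = s]. *)
Lemma shifted_coset s :
  shifted_set `&` coset_set (kappa s) = [set l s * group_val (n s)].
Proof.
apply/seteqP; split=> [_ [[t _ <-] st]|_ ->]; last first.
  by split; [exists s | exact: shifted_in_coset].
suff -> : t = s by [].
apply: (bij_inj (loop_iso_bij kappa)); apply: quotient_eq.
have := shifted_in_coset t; move: st; rewrite !(kappaE kappa S).
by move=> /lcoset_mem sE /lcoset_mem tE; exact: etrans (esym tE) sE.
Qed.

Hypothesis n1 : n 1 = 1.

Lemma shifted1 : shifted_set 1.
Proof. by exists 1 => //; rewrite n1 rep1 mul1g. Qed.

Lemma shifted_transversal_coset (C : quotient G) :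
  exists m, shifted_set `&` coset_set C = [set m].
Proof.
(* Surjectivity of [kappa] reduces to cosets of the form [kappa s]. *)
have [k _ kK] := loop_iso_bij kappa; rewrite -(kK C).
by eexists; exact: shifted_coset.
Qed.

Definition shifted_transversal : left_transversal G :=
  LeftTransversal shifted1 shifted_transversal_coset.
Local Notation S' := shifted_transversal.

(** [rep] is a choice known only through its singleton intersection, which [shifted_coset]
    computes. *)
Lemma rep_shifted s : rep kappa S' s = l s * group_val (n s).
Proof.
have : [set rep kappa S' s] (rep kappa S' s) by [].
by rewrite -repP [_ `&` _]shifted_coset.
Qed.

Lemma theta_shifted s :
  theta kappa S' s = aut_inv (inner (n s)) \oA theta kappa S s.
Proof.
apply: aut_eq => u; rewrite [RHS]aut_inv_innerE.
apply: (mulgI (n s)); rewrite !mulgA mulgV mul1g.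
apply: group_val_inj; apply: (@loop_mulI _ (l s)).
rewrite !group_valM -group_mul_middle -rep_shifted theta_funE rep_shifted.
(* Right nuclearity of [n s] brings both sides to [(u * l s) * n s]. *)
by rewrite -!group_mul_right theta_funE.
Qed.

Lemma factor_shifted s t :
  factor kappa S' s t =
  (n (s * t))^-1 * factor kappa S s t * theta kappa S t (n s) * n t.
Proof.
apply: (mulgI (n (s * t))); rewrite !mulgA mulgV mul1g.
apply: group_val_inj; apply: (@loop_mulI _ (l (s * t))).
rewrite !group_valM -group_mul_middle -rep_shifted factorE !rep_shifted.
rewrite -!group_mul_right factorE; congr (_ * _).
(* With [n t] split off on the right, [Theta_t] is what lets [n s] pass [l t]: both sides equal
   [l s * (n s * l t)]. *)
by rewrite group_mul_middle group_mul_right theta_funE.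
Qed.

End ChangeOfTransversal.

Theorem theorem51 (L K : loopType) (G : nuclear_normal_subgroup L)
    (kappa : loop_iso K (quotient G)) (Sigma : left_transversal G)
    (n : K -> group_of G) :
  n 1 = 1 ->
  let l := rep kappa Sigma in
  let Theta := schreier_theta (schreier_of kappa Sigma) in
  let f := schreier_factor (schreier_of kappa Sigma) in
  exists Sigma' : left_transversal G,
    [/\ transversal_set Sigma' = [set l s * group_val (n s) | s in [set: K]],
        forall s : K, coset_set (kappa s) (l s * group_val (n s)),
        forall s : K,
          schreier_theta (schreier_of kappa Sigma') s =
          aut_inv (inner (n s)) \oA Theta s &
        forall s t : K,
          schreier_factor (schreier_of kappa Sigma') s t =
          (n (s * t))^-1 * f s t * Theta t (n s) * n t].
Proof.
move=> n1 l Theta f; exists (shifted_transversal kappa Sigma n1).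
split=> [//|s|s|s t]; first exact: shifted_in_coset.
  exact: theta_shifted.
exact: factor_shifted.
Qed.
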